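(* Let $n$ be a positive integer and $0\le k\le n^2$ an integer. The number of partial Latin squares of order $n$ and size $k$ is at most $$\binom{n^2}{k}\frac{n!^{\,2n-\frac{k}{n}}\; e^{\,n\left(3+\frac{(\ln(2\pi n))^2}{4}\right)}}{\left(n-\frac{k}{n}\right)!^{\,2n}\; e^{k}},$$ where for a real number $x\ge 0$, $x!$ denotes $\Gamma(x+1)$.
   Context: A partial Latin square of order $n$ is an $n\times n$ array, some cells possibly empty, with entries from $\{1,\dots,n\}$ such that each symbol occurs at most once in each row and at most once in each column. Its size is the number of filled cells. *)

(* Defs.v *)
(* MathComp world, with MathComp-Analysis for the real-analytic side. *)
From mathcomp Require Import all_boot all_order all_algebra.
From mathcomp Require Import all_classical all_reals all_analysis.

Set Implicit Arguments.
Unset Strict Implicit.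
Unset Printing Implicit Defensive.

Import Order.TTheory GRing.Theory Num.Theory.

Local Open Scope ring_scope.

(* Arrays of order n are matrices over option 'I_n, where None is an empty
   cell; rows, columns and symbols are numbered from 0 to n - 1 instead of
   from 1 to n. *)
Definition partial_latin_square n (L : 'M[option 'I_n]_n) : bool :=
  [forall i : 'I_n, forall s : 'I_n,
     (#|[set j : 'I_n | L i j == Some s]%SET| <= 1)%N] &&
  [forall j : 'I_n, forall s : 'I_n,
     (#|[set i : 'I_n | L i j == Some s]%SET| <= 1)%N].

Definition pls_size n (L : 'M[option 'I_n]_n) : nat :=
  #|[set c : 'I_n * 'I_n | L c.1 c.2 != None]%SET|.

Definition num_pls (n k : nat) : nat :=
  #|[set L : 'M[option 'I_n]_n |
      partial_latin_square L && (pls_size L == k)]%SET|.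

(* Only meaningful for 0 < x: otherwise the integral diverges, and Rintegral
   then returns 0. *)
Definition Gamma (R : realType) (x : R) : R :=
  \int[@lebesgue_measure R]_(t in `]0, +oo[) (t `^ (x - 1) * expR (- t)).

Definition rfact (R : realType) (x : R) : R := Gamma (x + 1).

(* Main.v *)
Require Import Defs.
From mathcomp Require Import all_boot all_order all_algebra all_fingroup.
From mathcomp Require Import all_classical all_reals all_analysis.
From mathcomp Require Import measurable_realfun.
From mathcomp Require Import ring lra.

Import Order.TTheory GRing.Theory Num.Theory.

Local Open Scope ring_scope.

Set Implicit Arguments.
Unset Strict Implicit.
Unset Printing Implicit Defensive.

(* Fix the set S of filled cells and fill the rows from top to bottom. If row i
   has r_i cells in S, each way to fill it extends to (n - r_i)! permutations,
   and by Bregman's theorem the number of permutations that respect the columns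
   is at most the product over j of (d_j!)^(1/d_j), where d_j is the number of
   symbols not yet used in column j if (i, j) is in S, and n otherwise. Taking
   logarithms, the columns contribute sums of (ln d!)/d, compared with
   ln d - 1 by Stirling's formula with the sharp constant sqrt(2 pi); the total
   error per column is at most the sum over d <= n of
   ln(2 pi d)/(2 d) + 1/(4 d^2), hence at most 3 + ln(2 pi n)^2/4. Log-convexity
   of Gamma replaces the row and column sizes by their mean k/n, and there are
   'C(n^2, k) choices of S. *)

(** * Bregman's theorem *)

Section Bregman.
Variables (R : realType) (T : finType).
Implicit Types (A : T -> {set T}) (I : {set T}) (s : {perm T}).

(** The logarithm of Bregman's factor (d!)^(1/d); its value at d = 0 is 0. *)
Definition lnfact_avg (d : nat) : R := ln d`!%:R / d%:R.

Lemma mul_lnfact_avg d : d%:R * lnfact_avg d = ln d`!%:R.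
Proof.
case: d => [|d]; first by rewrite mul0r fact0 ln1.
by rewrite /lnfact_avg mulrCA divff ?mulr1// pnatr_eq0.
Qed.

Definition perms_in A : {set {perm T}} := [set s : {perm T} | [forall i, s i \in A i]]%SET.

Lemma perms_inP A s : reflect (forall i, s i \in A i) (s \in perms_in A).
Proof. by rewrite inE; exact: forallP. Qed.

(* Gibbs' inequality for the distribution of [s i], [s] uniform in
   [perms_in A]. *)
Lemma entropy_row A i : (0 < #|perms_in A|)%N ->
  \sum_(s in perms_in A) ln (#|perms_in A|%:R : R) <=
  \sum_(s in perms_in A) (ln (#|A i|%:R) +
     ln (#|[set s' in perms_in A | s' i == s i]%SET|%:R)).
Proof.
set P := perms_in A; set M := #|P| => M0.
pose N k := #|[set s in P | s i == k]%SET|.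
have N0 s : s \in P -> (0 < N (s i))%N.
  by move=> sP; apply/card_gt0P; exists s; rewrite inE sP eqxx.
have A0 : (0 < #|A i|)%N.
  have /card_gt0P[s /perms_inP sP] := M0.
  by apply/card_gt0P; exists (s i); exact: sP.
(* Each value k that some s in P takes at i contributes exactly 1: its [N k] permutations carry
   weight 1 / [N k] each. *)
have key : \sum_(s in P) (N (s i))%:R^-1 <= #|A i|%:R :> R.
  rewrite (partition_big (fun s : {perm T} => s i) (mem (A i)))/=; last first.
    by move=> s /perms_inP.
  rewrite -sum1_card natr_sum; apply: ler_sum => k kA.
  rewrite (eq_bigr (fun=> (N k)%:R^-1)); last by move=> s /andP[_ /eqP->].
  have -> : \sum_(j in P | j i == k) (N k)%:R^-1 =
            \sum_(j in [set s in P | s i == k]%SET) (N k)%:R^-1 :> R.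
    by apply: eq_bigl => s; rewrite inE.
  rewrite sumr_const -/(N k) -[leLHS]mulr_natr.
  have [->|Nk] := eqVneq (N k) 0%N; first by rewrite mulr0.
  by rewrite mulVf// pnatr_eq0.
rewrite -subr_ge0 -sumrB.
(* Termwise, ln x <= x - 1 at x = M / (|A i| N(s i)); by [key] the resulting lower bound has a
   nonnegative sum. *)
apply: (@le_trans _ _ (\sum_(s in P) (1 - M%:R / #|A i|%:R * (N (s i))%:R^-1))).
  rewrite sumrB -mulr_sumr sumr_const -/M subr_ge0.
  rewrite mulrAC ler_pdivrMr ?ltr0n//.
  by apply: ler_wpM2l.
apply: ler_sum => s sP; rewrite -/P -/(N (s i)).
have Ns := N0 s sP.
have MR : (0 : R) < M%:R by rewrite ltr0n.
have AR : (0 : R) < #|A i|%:R by rewrite ltr0n.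
have NR : (0 : R) < (N (s i))%:R by rewrite ltr0n.
have := @le_ln1Dx R (M%:R / #|A i|%:R * (N (s i))%:R^-1 - 1).
rewrite (addrC 1) subrK => /(_ _)/wrap[].
  by rewrite ltrBrDl addrN !mulr_gt0// invr_gt0.
rewrite lnM ?posrE ?divr_gt0 ?invr_gt0//.
rewrite ln_div ?posrE// lnV ?posrE//.
lra.
Qed.

(** Exactly d = |A j| indices i satisfy s i \in A j, and disjointness puts them all in I. Those
    other than j shrink A j to d - 1 elements, the remaining |I| - d leave it unchanged, and ln d +
    ln (d - 1)! = ln d! closes the count. *)
Lemma sum_lnfact_avg_row A I s j : s \in perms_in A -> j \in I ->
  (forall i k, i \notin I -> k != i -> [disjoint A i & A k]) ->
  ln (#|A j|%:R) + \sum_(i in I :\ j) lnfact_avg #|A j :\ s i| =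
  #|I|%:R * lnfact_avg #|A j|.
Proof.
move=> /perms_inP sP jI dis.
set d := #|A j|.
have d0 : (0 < d)%N by apply/card_gt0P; exists (s j).
pose X := [set i | s i \in A j]%SET.
have Xd : #|X| = d.
  rewrite -(card_imset _ (@perm_inj _ s)); congr (#|pred_of_set _|).
  apply/setP => k; apply/imsetP/idP => [[i]|kA]; first by rewrite inE => ? ->.
  by exists ((s^-1)%g k); rewrite ?inE permKV.
have XI : X \subset I.
  apply/fintype.subsetP => i; rewrite inE => sij; apply/negPn/negP => iI.
  have ji : j != i by apply: contraNneq iI => <-.
  have /disjointFr := dis i j iI ji.
  by move/(_ _ (sP i)); rewrite sij.
have jX : j \in X by rewrite inE.
rewrite (bigID (mem X))/=.
rewrite (eq_bigl (mem (X :\ j)%SET)); last first.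
  move=> i; rewrite !inE; case: (eqVneq i j) => //= ij.
  have := fintype.subsetP XI i; rewrite inE.
  by case: (s i \in A j) => [/(_ isT)->|_]; rewrite ?andbF.
rewrite (eq_bigr (fun=> lnfact_avg d.-1)); last first.
  move=> i; rewrite !inE => /andP[_ si].
  by rewrite /d (cardsD1 (s i) (A j)) si.
rewrite sumr_const.
have -> : #|(X :\ j)%SET| = d.-1 by rewrite -Xd (cardsD1 j X) jX.
rewrite (eq_bigl (mem (I :\: X)%SET)); last first.
  by move=> i; rewrite !inE andbC; case: (eqVneq i j) => //= ->; rewrite sP.
rewrite (eq_bigr (fun=> lnfact_avg d)); last first.
  move=> i; rewrite !inE => /andP[si _]; congr (lnfact_avg #|pred_of_set _|).
  apply/setP => k; rewrite !inE; case: eqVneq => // ->.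
  by rewrite (negbTE si).
rewrite sumr_const cardsD (finset.setIidPr XI) Xd.
have dI : (d <= #|I|)%N by rewrite -Xd subset_leq_card.
rewrite -(mulr_natl _ d.-1) -(mulr_natl _ (#|I| - d)).
rewrite mul_lnfact_avg natrB// mulrBl mul_lnfact_avg.
case: (d) d0 => // e _ /=.
rewrite factS natrM lnM ?posrE ?ltr0n ?fact_gt0//; lra.
Qed.

(* Schrijver's induction, with the rows outside [I] already determined instead
   of deleted: this avoids passing to minors. *)
Lemma bregman_active A I :
  (forall i, i \notin I -> (#|A i| <= 1)%N) ->
  (forall i k, i \notin I -> k != i -> [disjoint A i & A k]) ->
  (0 < #|perms_in A|)%N ->
  ln (#|perms_in A|%:R) <= \sum_(i in I) lnfact_avg #|A i|.
Proof.
elim: {I}#|I| {-2}I (erefl #|I|) A => [I /eqP|m IH I Im A A1 dis P0].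
  rewrite cards_eq0 => /eqP-> A A1 _ _.
  rewrite big_set0 ln_le0// lern1.
  apply/card_le1P => s sP t; rewrite !inE.
  apply/idP/eqP => [/forallP tP|->]; last by move: sP; rewrite inE.
  move/perms_inP : sP => sP.
  apply/permP => i; have /card_le1_eqP : (#|A i| <= 1)%N by apply: A1; rewrite inE.
  by apply.
set P := perms_in A; set M := #|P|.
have [i0 i0I] : exists i, i \in I by apply/card_gt0P; rewrite Im.
have mI : (0 : R) < #|I|%:R by rewrite Im ltr0n.
have M0 : (0 : R) < M%:R by rewrite ltr0n.
rewrite -(ler_pM2l mI) -(ler_pM2l M0).
(* Both sides are multiplied by |P| |I|, so as to average over the permutation s and over the active
   row i exposed first. *)
have -> : M%:R * (#|I|%:R * ln M%:R) = \sum_(i in I) \sum_(s in P) ln M%:R :> R.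
  by rewrite !sumr_const mulrCA !mulr_natl.
apply: (@le_trans _ _ (\sum_(i in I) \sum_(s in P)
   (ln #|A i|%:R + ln #|[set s' in P | s' i == s i]%SET|%:R))).
  by apply: ler_sum => i _; exact: entropy_row.
rewrite exchange_big/=.
rewrite mulr_natl -sumr_const; apply: ler_sum => s sP.
(* The identity for a single row is read from right to left, so that the terms ln |A i| cancel and
   only the sums handled by induction remain. *)
rewrite mulr_sumr -[leRHS](eq_bigr _ (fun j jI =>
   @sum_lnfact_avg_row A I s j sP jI dis)).
rewrite !big_split/= lerD2l.
rewrite [leRHS](exchange_big_dep (mem I))/=; last first.
  by move=> i j iI; rewrite !inE => /andP[].
apply: ler_sum => i iI.
move/perms_inP : (sP) => sPA.
(* Row i is fixed to the value s i, which is removed from every other row; i thus leaves the active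
   set while the two conditions on inactive rows persist. *)
pose B j := if j == i then [set s i]%SET else A j :\ s i.
have sub : [set s' in P | s' i == s i]%SET \subset perms_in B.
  apply/fintype.subsetP => t; rewrite inE => /andP[/perms_inP tP /eqP ti].
  apply/perms_inP => j; rewrite /B; case: eqVneq => [->|ji].
    by rewrite ti inE.
  by rewrite !inE tP andbT -ti (inj_eq perm_inj).
have N0 : (0 < #|[set s' in P | s' i == s i]%SET|)%N.
  by apply/card_gt0P; exists s; rewrite inE sP eqxx.
have PB0 : (0 < #|perms_in B|)%N := leq_trans N0 (subset_leq_card sub).
apply: (@le_trans _ _ (ln #|perms_in B|%:R)).
  by rewrite ler_ln ?posrE ?ltr0n// ler_nat subset_leq_card.
have Im' : #|I :\ i| = m by move: Im; rewrite (cardsD1 i I) iI => -[].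
have B1 j : j \notin I :\ i -> (#|B j| <= 1)%N.
  rewrite !inE negb_and negbK /B.
  case: eqVneq => [_ _|ji /= jI]; first by rewrite cards1.
  by rewrite (leq_trans _ (A1 j jI))// subset_leq_card// subsetDl.
have Bdis j k : j \notin I :\ i -> k != j -> [disjoint B j & B k].
  rewrite !inE negb_and negbK /B.
  case: (eqVneq j i) => [->|ji] /= => [_ ki|jI kj].
    by rewrite (negbTE ki) disjoints1 !inE eqxx.
  case: (eqVneq k i) => [ki|ki].
    by rewrite disjoint_sym disjoints1 !inE eqxx.
  by apply: disjointW (dis j k jI kj); exact: subsetDl.
have := IH (I :\ i) Im' B B1 Bdis PB0.
move=> /le_trans; apply.
rewrite le_eqVlt; apply/orP; left; apply/eqP.
apply: eq_big => j.
  by rewrite !inE iI andbT andbC [in RHS]eq_sym.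
by rewrite !inE /B => /andP[/negbTE ->].
Qed.

Theorem bregman A : (0 < #|perms_in A|)%N ->
  ln (#|perms_in A|%:R) <= \sum_i lnfact_avg #|A i|.
Proof.
move=> P0; have := @bregman_active A [set: T]%SET.
rewrite [X in _ -> _ -> _ -> _ <= X](eq_bigl xpredT); last by move=> i; rewrite inE.
by apply => // i; rewrite inE.
Qed.

End Bregman.

(** * Filling a set of cells row by row *)

Section PartialInjections.
Variable T : finType.
Implicit Types (rho : {ffun T -> option T}) (C : {set T}).

Definition partial_inj rho := forall x y s,
  rho x = Some s -> rho y = Some s -> x = y.

(** The complements of the domain and of the image have the same size, so matching their
    enumerations in order completes [rho] to a permutation. *)
Lemma extend_partial_inj rho : partial_inj rho ->
  exists s : {perm T}, forall x y, rho x = Some y -> s x = y.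
Proof.
move=> rhoI.
pose C := [set x | rho x != None]%SET.
pose f x := odflt x (rho x).
have fI : {in C &, injective f}.
  move=> x y; rewrite !inE /f.
  case ex: (rho x) => [a|//] _; case ey: (rho y) => [b|//] _ /= ab.
  by apply: (rhoI x y a) => //; rewrite ey ab.
pose D := ~: C; pose E := ~: (f @: C)%SET.
have DE : #|D| = #|E|.
  have := cardsC C; have := cardsC (f @: C)%SET.
  rewrite card_in_imset// => <- /eqP; rewrite eqn_add2l => /eqP; exact.
pose h x := if x \in C then f x else nth x (enum E) (index x (enum D)).
have hE x : x \notin C -> h x \in E.
  move=> xC; rewrite /h (negbTE xC) -mem_enum mem_nth//.
  by rewrite -cardE -DE cardE index_mem mem_enum inE.
have hI : injective h.
  move=> x y; have [xC|xC] := boolP (x \in C); have [yC|yC] := boolP (y \in C).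
  - by rewrite /h xC yC; exact: fI.
  - move=> hxy; have := hE _ yC; rewrite -hxy /h xC inE.
    by rewrite imset_f.
  - move=> hxy; have := hE _ xC; rewrite hxy /h yC inE.
    by rewrite imset_f.
  - have xD : x \in enum D by rewrite mem_enum inE.
    have yD : y \in enum D by rewrite mem_enum inE.
    have ltE z : z \in enum D -> (index z (enum D) < size (enum E))%N.
      by rewrite -cardE -DE cardE index_mem.
    rewrite /h (negbTE xC) (negbTE yC) (set_nth_default y)//; last exact: ltE.
    move=> /eqP; rewrite nth_uniq ?enum_uniq ?ltE// => /eqP.
    by move=> /index_inj; apply.
exists (perm hI) => x y xy.
by rewrite permE /h inE xy /= /f xy.
Qed.

(** Fix a completion [e rho] of each [rho]. Composing it with a permutation p that moves only points
    outside C gives another completion. The pair (rho, p) is recovered from the composite: its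
    restriction to C gives [rho], and then [e rho] cancels. *)
Lemma card_partial_inj (F : {set {ffun T -> option T}}) C (A : T -> {set T}) :
  (forall rho, rho \in F -> partial_inj rho) ->
  (forall rho x, rho \in F -> (rho x != None) = (x \in C)) ->
  (forall rho x y, rho \in F -> rho x = Some y -> y \in A x) ->
  (forall x, x \notin C -> A x = [set: T]%SET) ->
  (#|F| * (#|~: C|)`! <= #|perms_in A|)%N.
Proof.
move=> FI FC FA AC.
have /choice[e eP] : forall rho, exists s : {perm T},
    rho \in F -> forall x y, rho x = Some y -> s x = y.
  move=> rho.
  have [rhoF|_] := boolP (rho \in F); last by exists 1%g.
  by have [s sP] := extend_partial_inj (FI _ rhoF); exists s.
have eE rho p x : rho \in F -> p \in perm_on (~: C) -> x \in C ->
    rho x = Some ((p * e rho)%g x).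
  move=> rhoF pC xC; rewrite permM (out_perm pC) ?inE ?xC//.
  have := FC _ x rhoF; rewrite xC; case ex: (rho x) => [y|//] _.
  by rewrite (eP _ rhoF _ _ ex).
rewrite -(card_perm (~: C)) -[#|perm_on _|]cardsE -cardsX.
set X := finset.setX _ _.
have inj : {in X &, injective
    (fun u : {ffun T -> option T} * {perm T} => (u.2 * e u.1)%g)}.
  move=> [rho p] [rho' p']; rewrite !inE /= => /andP[r1 p1] /andP[r2 p2] eq.
  suff rr : rho = rho'.
    by subst rho'; congr (_, _); apply: (mulIg (e rho)).
  apply/ffunP => x; have [xC|xC] := boolP (x \in C).
    by rewrite (eE rho p) ?(eE rho' p') ?eq.
  have None_x r : r \in F -> r x = None.
    by move=> rF; apply/eqP; rewrite -[_ == _]negbK FC.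
  by rewrite !None_x.
rewrite -(card_in_imset inj); apply: subset_leq_card.
apply/fintype.subsetP => s /imsetP[[rho p]]; rewrite !inE /= => /andP[r1 p1] ->.
apply/forallP => x; have [xC|xC] := boolP (x \in C).
  by rewrite (FA rho)// (eE rho p).
by rewrite AC ?inE.
Qed.

End PartialInjections.

(** * Arrays with a prescribed set of filled cells *)

Section Filling.
Variables (R : realType) (n : nat).
Implicit Types (L : 'M[option 'I_n]_n) (S : {set 'I_n * 'I_n}).

Definition filled L : {set 'I_n * 'I_n} := [set c | L c.1 c.2 != None]%SET.

Definition fillings S : {set 'M[option 'I_n]_n} :=
  [set L | partial_latin_square L & filled L == S]%SET.

Definition row_size S (i : 'I_n) := #|[set j | (i, j) \in S]%SET|.

Definition col_size S (j : 'I_n) := #|[set i | (i, j) \in S]%SET|.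

Definition upper_rows S m : {set 'I_n * 'I_n} := [set c in S | (c.1 < m)%N]%SET.

Lemma plsP L : reflect
  ((forall i j j' s, L i j = Some s -> L i j' = Some s -> j = j') /\
   (forall j i i' s, L i j = Some s -> L i' j = Some s -> i = i'))
  (partial_latin_square L).
Proof.
apply: (iffP andP) => [[/forallP r /forallP c]|[r c]].
- split=> [i j j' s|j i i' s] e e'.
  + have /forallP/(_ s)/card_le1_eqP := r i.
    by apply; rewrite inE ?e ?e'.
  + have /forallP/(_ s)/card_le1_eqP := c j.
    by apply; rewrite inE ?e ?e'.
- split; apply/forallP => i; apply/forallP => s; apply/card_le1_eqP => x y;
    rewrite !inE => /eqP ex /eqP ey.
  + exact: (r i y x s).
  + exact: (c i y x s).
Qed.

Lemma fillingsP L S : reflect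
  ([/\ forall i j j' s, L i j = Some s -> L i j' = Some s -> j = j',
       forall j i i' s, L i j = Some s -> L i' j = Some s -> i = i' &
       forall i j, (L i j != None) = ((i, j) \in S)])
  (L \in fillings S).
Proof.
rewrite inE; apply: (iffP andP) => [[/plsP[r c] /eqP <-]|[r c f]].
  by split=> // i j; rewrite inE.
by split; [apply/plsP | apply/eqP/setP => -[i j]; rewrite inE f].
Qed.

Lemma num_pls_sum k : num_pls n k =
  (\sum_(S : {set 'I_n * 'I_n} | #|S| == k) #|fillings S|)%N.
Proof.
rewrite /num_pls -sum1_card.
rewrite (partition_big filled (fun S => #|S| == k))/=; last first.
  by move=> L; rewrite inE => /andP[_].
apply: eq_bigr => S /eqP Sk; rewrite -sum1_card; apply: eq_bigl => L.
rewrite !inE /pls_size -/(filled L).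
by case: (eqVneq (filled L) S) => [->|_]; rewrite ?andbF// Sk eqxx !andbT.
Qed.

Definition erase_row (m : 'I_n) L : 'M[option 'I_n]_n :=
  \matrix_(i, j) if i == m then None else L i j.

(* Columns in which row m is to stay empty are unconstrained, since the row is
   completed to a permutation. *)
Definition allowed S (m : 'I_n) L (j : 'I_n) : {set 'I_n} :=
  if (m, j) \in S then [set s | [forall i, L i j != Some s]]%SET else [set: 'I_n]%SET.

(** The filled cells of a column carry distinct symbols, so the symbols used above row m are as many
    as the filled cells there. *)
Lemma card_allowed S (m : 'I_n) L j : L \in fillings (upper_rows S m) ->
  #|allowed S m L j| =
  if (m, j) \in S then (n - col_size (upper_rows S m) j)%N else n.
Proof.
move=> /fillingsP[r c f]; rewrite /allowed; case: ifP => _; last first.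
  by rewrite cardsT card_ord.
pose X := [set s | [exists i, L i j == Some s]]%SET.
have -> : [set s | [forall i, L i j != Some s]]%SET = ~: X.
  by apply/setP => s; rewrite !inE negb_exists.
suff XE : #|X| = col_size (upper_rows S m) j.
  by rewrite cardsCs finset.setCK card_ord XE.
rewrite /col_size; set Y := [set i | _]%SET.
have YE i : (i \in Y) = (L i j != None) by rewrite f !inE.
rewrite -(card_imset _ (@Some_inj _)).
rewrite -(@card_in_imset _ _ (fun i => L i j) Y); last first.
  move=> i i'; rewrite !YE; case e: (L i j) => [a|//] _ _ e'.
  by apply: (c j i i' a).
congr #|pred_of_set _|; apply/setP => o; apply/imsetP/imsetP => -[].
  move=> s; rewrite inE => /existsP[i /eqP Lij] ->.
  by exists i; rewrite ?YE Lij.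
move=> i; rewrite YE; case e: (L i j) => [s|//] _ ->.
by exists s => //; rewrite inE; apply/existsP; exists i; rewrite e.
Qed.

(** An extension is determined by its row m, which is a partial injection defined on the columns
    where S meets that row; each such row has (n - [row_size S m])! completions, all within the
    allowed sets. *)
Lemma card_extensions S (m : 'I_n) L : L \in fillings (upper_rows S m) ->
  (#|[set L' in fillings (upper_rows S m.+1) | erase_row m L' == L]%SET| *
    (n - row_size S m)`! <= #|perms_in (allowed S m L)|)%N.
Proof.
move=> LS.
set X := [set L' in _ | _]%SET.
pose row_of (L' : 'M[option 'I_n]_n) := [ffun j => L' m j].
pose C := [set j | (m, j) \in S]%SET.
have inj : {in X &, injective row_of}.
  move=> L1 L2; rewrite !inE => /andP[_ /eqP e1] /andP[_ /eqP e2] e12.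
  apply/matrixP => i j; have [->|im] := eqVneq i m.
    by have /ffunP/(_ j) := e12; rewrite !ffunE.
  have : erase_row m L1 = erase_row m L2 by rewrite e1 e2.
  by move=> /matrixP/(_ i j); rewrite !mxE (negbTE im).
rewrite -(card_in_imset inj).
have -> : (n - row_size S m)%N = #|~: C|.
  by rewrite cardsCs finset.setCK card_ord.
apply: card_partial_inj.
- move=> _ /imsetP[L' + ->]; rewrite inE => /andP[/fillingsP[r _ _] _].
  by move=> x y s; rewrite !ffunE; exact: r.
- move=> _ x /imsetP[L' + ->]; rewrite inE => /andP[/fillingsP[_ _ f] _].
  by rewrite ffunE f !inE ltnSn andbT.
- move=> _ x y /imsetP[L' + ->]; rewrite inE => /andP[/fillingsP[_ c f] /eqP eL].
  rewrite ffunE => xy; rewrite /allowed; case: ifP; rewrite ?inE// => _.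
  apply/forallP => i; rewrite -eL mxE; case: (eqVneq i m) => // im.
  by apply/eqP => e; move: im; rewrite (c _ _ _ _ e xy) eqxx.
- by move=> x; rewrite inE /allowed => /negbTE ->.
Qed.

Lemma erase_row_fillings S (m : 'I_n) L :
  L \in fillings (upper_rows S m.+1) -> erase_row m L \in fillings (upper_rows S m).
Proof.
move=> /fillingsP[r c f]; apply/fillingsP; split.
- by move=> i j j' s; rewrite !mxE; case: ifP => // _; exact: r.
- by move=> j i i' s; rewrite !mxE; case: ifP => // _; case: ifP => // _; exact: c.
- move=> i j; rewrite !mxE !inE /=; case: (eqVneq i m) => [->|im].
    by rewrite ltnn andbF.
  by rewrite f !inE/= ltnS (leq_eqVlt i) (inj_eq val_inj) (negbTE im).
Qed.

End Filling.

(** * The entropy bound on the fillings of a fixed set *)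

Section FillingBound.
Variables (R : realType) (n : nat).
Implicit Types (L : 'M[option 'I_n]_n) (S : {set 'I_n * 'I_n}).
Local Notation g := (lnfact_avg R).

Lemma col_size_upper_rowsS S (m : 'I_n) j :
  col_size (upper_rows S m.+1) j = (((m, j) \in S) + col_size (upper_rows S m) j)%N.
Proof.
rewrite /col_size (cardsD1 m) !inE ltnSn andbT; congr (_ + #|pred_of_set _|)%N.
apply/setP => i; rewrite !inE /= ltnS (leq_eqVlt i) (inj_eq val_inj).
by case: (eqVneq i m) => [->|] //=; rewrite ltnn andbF.
Qed.

(** The extensions are grouped by the array that remains when row m is erased; Bregman's theorem
    bounds each group, and the subtracted logarithm accounts for the completions of row m. *)
Lemma card_fillingsS S (m : 'I_n) :
  #|fillings (upper_rows S m.+1)|%:R <= #|fillings (upper_rows S m)|%:R *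
    expR (\sum_j g (if (m, j) \in S then (n - col_size (upper_rows S m) j)%N else n) -
          ln (n - row_size S m)`!%:R) :> R.
Proof.
rewrite -[X in X%:R <= _]sum1_card.
rewrite (partition_big (@erase_row _ m) (mem (fillings (upper_rows S m))))/=; last first.
  by move=> L; exact: erase_row_fillings.
rewrite natr_sum mulr_natl -sumr_const; apply: ler_sum => L LS.
rewrite (eq_bigl (mem [set L' in fillings (upper_rows S m.+1) |
  erase_row m L' == L]%SET)); last by move=> L'; rewrite !inE.
rewrite sum1_card.
set X := [set _ in _ | _]%SET.
have f0 : (0 : R) < (n - row_size S m)`!%:R by rewrite ltr0n fact_gt0.
have := card_extensions LS; rewrite -/X -(ler_nat R) natrM.
rewrite -ler_pdivlMr// => /le_trans; apply.
(* With no admissible permutation the bound is trivial; otherwise Bregman's theorem applies. *)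
have [->|P0] := posnP #|perms_in (allowed S m L)|.
  by rewrite mul0r expR_ge0.
have P0' : (0 : R) < #|perms_in (allowed S m L)|%:R by rewrite ltr0n.
rewrite -ler_ln ?posrE ?expR_gt0 ?divr_gt0// expRK ln_div ?posrE// lerD2r.
rewrite (le_trans (bregman R P0))// ler_sum// => j _.
by rewrite (card_allowed _ LS).
Qed.

(** An empty cell costs [g n], and a filled cell with t filled cells above it in its column costs
    [g (n - t)]. Going down a column, t runs through 0, 1, 2, ..., so only the number of filled
    cells matters, not the rows in which they lie. *)
Lemma card_fillings_upper S m : (m <= n)%N ->
  #|fillings (upper_rows S m)|%:R <= expR (
    \sum_(i < n | (i < m)%N) ((n - row_size S i)%:R * g n - ln (n - row_size S i)`!%:R) +
    \sum_j \sum_(t < col_size (upper_rows S m) j) g (n - t)) :> R.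
Proof.
elim: m => [_|m IH mn].
  rewrite big_pred0// add0r big1; last first.
    move=> j _; have -> : col_size (upper_rows S 0) j = 0%N.
      by apply: eq_card0 => i; rewrite !inE andbF.
    by rewrite big_ord0.
  rewrite expR0 lern1; apply/card_le1_eqP => L L' LS LS'.
  apply/matrixP => i j.
  have N0 M : M \in fillings (upper_rows S 0) -> M i j = None.
    by move=> /fillingsP[_ _ /(_ i j)]; rewrite !inE andbF => /negbT/negPn/eqP.
  by rewrite !N0.
pose mo := Ordinal mn.
apply: (le_trans (@card_fillingsS S mo)).
apply: (le_trans (ler_wpM2r (expR_ge0 _) (IH (ltnW mn)))).
rewrite -expRD ler_expR.
rewrite [in leRHS](bigD1 mo)//=.
rewrite [in leRHS](eq_bigl (fun i : 'I_n => (i < m)%N)); last first.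
  by move=> i; rewrite ltnS [RHS]ltn_neqAle andbC.
rewrite [X in _ <= _ + X](eq_bigr (fun j =>
   (if (mo, j) \in S then g (n - col_size (upper_rows S m) j) else 0) +
   \sum_(t < col_size (upper_rows S m) j) g (n - t))); last first.
  move=> j _; rewrite (@col_size_upper_rowsS S mo).
  by case: ifP => _; rewrite ?add0r// add1n big_ord_recr/= addrC.
rewrite big_split/=.
rewrite big_split/= [X in _ + (X - _) <= _](eq_bigr (fun j =>
   (if (mo, j) \in S then g (n - col_size (upper_rows S m) j) else 0) +
   (if (mo, j) \in S then 0 else g n))); last first.
  by move=> j _; case: ifP; rewrite ?add0r ?addr0.
rewrite [X in _ + (X - _) <= _]big_split/=.
have -> : \sum_(j < n) (if (mo, j) \in S then 0 else g n) = (n - row_size S mo)%:R * g n.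
  rewrite (eq_bigr (fun j => if (mo, j) \notin S then g n else 0)); last first.
    by move=> j _; case: ifP.
  rewrite -big_mkcond sumr_const/= [RHS]mulr_natl; congr (_ *+ _).
  have := cardsCs (~: [set j | (mo, j) \in S]%SET).
  rewrite finset.setCK card_ord => <-; apply: eq_card => j.
  by rewrite !inE.
set a := \sum_(i < n | _) _; lra.
Qed.

Theorem card_fillings S :
  #|fillings S|%:R <= expR (
    \sum_i ((n - row_size S i)%:R * g n - ln (n - row_size S i)`!%:R) +
    \sum_j \sum_(t < col_size S j) g (n - t)) :> R.
Proof.
have := @card_fillings_upper S n (leqnn n).
have -> : upper_rows S n = S by apply/setP => -[i j]; rewrite !inE ltn_ord andbT.
by rewrite (eq_bigl xpredT)// => i; rewrite ltn_ord.
Qed.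

End FillingBound.

(** * Stirling's formula *)

Section Wallis.
Import numFieldNormedType.Exports.
Local Open Scope classical_set_scope.
Variable R : realType.
Local Notation mu := (@lebesgue_measure R).

Lemma Rintegral_derive (F f : R -> R) (a b : R) : a < b ->
  (forall x : R, is_derive x 1 F (f x)) -> continuous f ->
  \int[mu]_(x in `[a, b]) f x = F b - F a.
Proof.
move=> ab dF cf.
have cF : continuous F.
  by move=> x; apply/differentiable_continuous/derivable1_diffP.
rewrite /Rintegral (@continuous_FTC2 _ f F)//.
- exact: continuous_subspaceT.
- split => //.
  + exact/cvg_at_right_filter/cF.
  + exact/cvg_at_left_filter/cF.
- by move=> x _; rewrite derive1E derive_val.
Qed.

Definition sin_integral n : R := \int[mu]_(x in `[0, pi / 2]) sin x ^+ n.

Lemma continuous_mul_sinX (k : R) n : continuous (fun x : R => k * sin x ^+ n).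
Proof.
move=> x; apply: (@continuousM _ _ (fun=> k) (fun x => sin x ^+ n)); first exact: cvg_cst.
apply: (@continuous_comp _ _ _ sin (fun y : R => y ^+ n)).
  exact: continuous_sin.
exact: exprn_continuous.
Qed.

Lemma integrable_mul_sinX (k : R) n :
  mu.-integrable `[0, pi / 2] (EFin \o (fun x : R => k * sin x ^+ n)).
Proof.
apply: continuous_compact_integrable; first exact: segment_compact.
exact: continuous_subspaceT (@continuous_mul_sinX k n).
Qed.

Lemma integrable_sinX n :
  mu.-integrable `[0, pi / 2] (EFin \o (fun x : R => sin x ^+ n)).
Proof.
have := integrable_mul_sinX 1 n.
by congr (mu.-integrable _ _); apply/funext => x /=; rewrite mul1r.
Qed.

Lemma sin_integral0 : sin_integral 0 = pi / 2.
Proof.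
have dF (x : R) : is_derive x 1 (id : R -> R) (sin x ^+ 0).
  by rewrite expr0; exact: is_derive_id.
rewrite /sin_integral (Rintegral_derive _ dF) ?subr0//.
  by rewrite divr_gt0 ?pi_gt0.
by move=> x; apply: cvg_cst.
Qed.

Lemma sin_integral1 : sin_integral 1 = 1.
Proof.
have dF (x : R) : is_derive x 1 (fun x => - cos x) (sin x ^+ 1).
  by apply: is_derive_eq; rewrite opprK expr1.
rewrite /sin_integral (Rintegral_derive _ dF).
- by rewrite cos_pihalf cos0 oppr0 opprK add0r.
- by rewrite divr_gt0 ?pi_gt0.
- by move=> x; exact: continuous_sin.
Qed.

(** The difference of the two sides integrates the derivative of cos x sin^(n+1) x, which vanishes
    at both 0 and pi / 2. *)
Lemma sin_integralSS n :
  n.+2%:R * sin_integral n.+2 = n.+1%:R * sin_integral n.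
Proof.
have itv_lt : (0 : R) < pi / 2 by rewrite divr_gt0 ?pi_gt0.
apply/esym/eqP; rewrite -subr_eq0; apply/eqP.
rewrite /sin_integral -!RintegralZl//; [|exact: integrable_sinX..].
rewrite -RintegralB//; [|exact: integrable_mul_sinX..].
have dF (x : R) : is_derive x 1 (fun x => cos x * sin x ^+ n.+1)
    (n.+1%:R * sin x ^+ n - n.+2%:R * sin x ^+ n.+2).
  have -> : (fun x : R => cos x * sin x ^+ n.+1) = cos * sin ^+ n.+1.
    by apply/funext => y /=; rewrite !fctE.
  apply: is_derive_eq; rewrite /GRing.scale /= exprfctE !exprS -[n.+2%:R]natr1.
  have c2 : cos x * cos x = 1 - sin x * sin x by rewrite -!expr2 cos2sin2.
  ring: c2.
rewrite (Rintegral_derive itv_lt dF).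
  by rewrite cos_pihalf sin0 mul0r expr0n mulr0 subr0.
move=> x; apply: (@continuousB _ _ _ (fun x => _ * sin x ^+ _) (fun x => _ * sin x ^+ _));
  exact: continuous_mul_sinX.
Qed.

Lemma sin_integral_le n : sin_integral n.+1 <= sin_integral n.
Proof.
apply: le_Rintegral => //; [exact: integrable_sinX..|].
move=> x /=; rewrite in_itv/= => /andP[x0 x1].
have s0 : 0 <= sin x.
  by apply: sin_ge0_pi; rewrite x0 (le_trans x1)// ler_pdivrMr// ler_peMr ?pi_ge0 ?ler1n.
by rewrite exprS ler_piMl ?exprn_ge0// sin_le1.
Qed.

(** The recurrence makes the left side independent of n. *)
Lemma sin_integral_mul n :
  n.+1%:R * (sin_integral n * sin_integral n.+1) = pi / 2.
Proof.
elim: n => [|n IH]; first by rewrite sin_integral0 sin_integral1 mulr1 mul1r.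
by rewrite mulrCA sin_integralSS -IH; ring.
Qed.

Lemma sin_integral_even m :
  sin_integral m.*2 * (4 ^+ m * m`!%:R ^+ 2) = pi / 2 * (m.*2)`!%:R.
Proof.
elim: m => [|m IH]; first by rewrite sin_integral0 /= fact0 expr0 expr1n !mulr1.
have m2 : m.*2.+2%:R = 2 * m.+1%:R :> R by rewrite -natrM mul2n.
rewrite doubleS !factS !natrM [LHS](_ : _ = 2 * m.+1%:R * (m.*2.+2%:R * sin_integral m.*2.+2)
  * (4 ^+ m * m`!%:R ^+ 2)); last by rewrite m2 exprS; ring.
rewrite sin_integralSS [LHS](_ : _ = 2 * m.+1%:R * m.*2.+1%:R *
  (sin_integral m.*2 * (4 ^+ m * m`!%:R ^+ 2))); last by ring.
by rewrite IH m2; ring.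
Qed.

(** Writing I_n for [sin_integral n], monotonicity gives pi / 2 = (2m + 1) I_(2m) I_(2m+1) <= (2m +
    1) I_(2m)^2; the closed form of I_(2m) turns this into factorials. *)
Lemma wallis_le m :
  2 * (4 ^+ m * m`!%:R ^+ 2) ^+ 2 <= pi * m.*2.+1%:R * (m.*2)`!%:R ^+ 2 :> R.
Proof.
have pi0 : (0 : R) < pi := pi_gt0 R.
set w := 4 ^+ m * m`!%:R ^+ 2.
have w0 : 0 < w by rewrite /w mulr_gt0 ?exprn_gt0// ltr0n fact_gt0.
have s0 : 0 <= sin_integral m.*2.
  have := sin_integral_even m; rewrite -/w => e.
  by rewrite -(pmulr_lge0 _ w0) e mulr_ge0// divr_ge0// ltW.
have le1 : pi / 2 <= m.*2.+1%:R * sin_integral m.*2 ^+ 2.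
  rewrite -(sin_integral_mul m.*2) ler_wpM2l// expr2 ler_wpM2l//.
  exact: sin_integral_le.
have e := sin_integral_even m; rewrite -/w in e.
have : pi / 2 * w ^+ 2 <= m.*2.+1%:R * (pi / 2 * (m.*2)`!%:R) ^+ 2.
  rewrite -e [leRHS](_ : _ = m.*2.+1%:R * sin_integral m.*2 ^+ 2 * w ^+ 2); last by ring.
  by rewrite ler_wpM2r// exprn_ge0// ltW.
set f := (m.*2)`!%:R; set k := m.*2.+1%:R => h.
rewrite -(ler_pM2l (_ : 0 < pi / 4)) ?divr_gt0//.
have -> : pi / 4 * (2 * w ^+ 2) = pi / 2 * w ^+ 2 by field.
by rewrite (le_trans h)// le_eqVlt; apply/orP; left; apply/eqP; field.
Qed.

End Wallis.

(** * Explicit error terms in Stirling's formula *)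

Section Stirling.
Import numFieldNormedType.Exports.
Variable R : realType.

(** The function ln x + 4 / (x + 1) has derivative (x - 1)^2 / (x (x + 1)^2) >= 0 and value 2 at x =
    1, while the left side equals 2 - 4 / (y + 1). *)
Lemma ln_ge_pade (y : R) : 1 <= y -> 2 * (y - 1) / (y + 1) <= ln y.
Proof.
move=> y1.
pose f (x : R) := ln x + 4 * (x + 1)^-1.
pose df (x : R) := x^-1 - 4 / (x + 1) ^+ 2.
have dfP (x : R) : 1 <= x -> is_derive x 1 f (df x).
  move=> x1.
  have x0 : 0 < x by exact: lt_le_trans x1.
  have x10 : x + 1 != 0 by rewrite gt_eqF// addr_gt0.
  have d1 : is_derive x 1 (fun x : R => x + 1) 1.
    by apply: is_derive_eq; rewrite addr0.
  have d2 : is_derive x 1 (fun x : R => (x + 1)^-1) (- (x + 1) ^- 2 *: 1).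
    by apply: (@is_deriveV _ (fun x : R => x + 1)).
  have h := is_deriveD (is_derive1_ln x0) (is_deriveZ 4 d2).
  by apply: (is_derive_eq h); rewrite /df /GRing.scale /= mulr1 mulrN.
have [||c /[!in_itv]/= /andP[c1 _]] := @MVT_segment _ f df 1 y y1.
- by move=> x /[!in_itv]/= /andP[/ltW x1 _]; exact: dfP.
- apply: derivable_within_continuous => x /[!in_itv]/= /andP[x1 _].
  by have [] := dfP x x1.
rewrite /f ln1 => e.
have c0 : 0 < c by exact: lt_le_trans c1.
have dc : 0 <= df c.
  have -> : df c = (c - 1) ^+ 2 / (c * (c + 1) ^+ 2).
    by rewrite /df; field; rewrite (gt_eqF c0) (gt_eqF (addr_gt0 c0 ltr01)).
  by rewrite divr_ge0 ?sqr_ge0// mulr_ge0 ?sqr_ge0// ltW.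
have : 0 <= df c * (y - 1) by rewrite mulr_ge0// subr_ge0.
rewrite -e.
have -> : 2 * (y - 1) / (y + 1) = 2 - 4 * (y + 1)^-1.
  by field; rewrite gt_eqF//; lra.
have -> : (1 + 1 : R)^-1 = 2^-1 by [].
lra.
Qed.

(** The logarithm of d! / (d^(d + 1/2) e^(-d)). *)
Definition stirling_defect (d : nat) : R :=
  ln d`!%:R - (d%:R + 2^-1) * ln d%:R + d%:R.

(** The decrement is (d + 1/2) ln ((d + 1) / d) - 1, and at y = (d + 1) / d the lower bound of
    [ln_ge_pade] is exactly 1 / (d + 1/2). *)
Lemma stirling_defectS d : (0 < d)%N -> stirling_defect d.+1 <= stirling_defect d.
Proof.
move=> d0; rewrite /stirling_defect factS natrM lnM ?posrE ?ltr0n ?fact_gt0//.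
have dR : (0 : R) < d%:R by rewrite ltr0n.
have := @ln_ge_pade (d.+1%:R / d%:R).
rewrite ler_pdivlMr// mul1r ler_nat leqnSn => /(_ isT).
rewrite ln_div ?posrE ?ltr0n//.
have -> : 2 * (d.+1%:R / d%:R - 1) / (d.+1%:R / d%:R + 1) = (d%:R + 2^-1)^-1 :> R.
  by rewrite -natr1; field; rewrite !gt_eqF//; lra.
have k0 : 0 < d%:R + 2^-1 :> R by rewrite addr_gt0.
rewrite -(ler_pM2l k0) divff ?gt_eqF// -natr1.
lra.
Qed.

Lemma stirling_defect_le m d : (0 < m <= d)%N -> stirling_defect d <= stirling_defect m.
Proof.
move=> /andP[m0]; elim: d => [|d IH]; first by rewrite leqNgt m0.
rewrite leq_eqVlt => /predU1P[->//|]; rewrite ltnS => md.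
by rewrite (le_trans _ (IH md))// stirling_defectS// (leq_trans m0).
Qed.

(** Monotonicity gives defect(m) <= 2 defect(m) - defect(2m). In the right side the powers of m
    cancel up to a square root, and Wallis's inequality bounds it by (ln (2 pi) + ln (1 + 1/(2m))) /
    2. *)
Lemma stirling_defect_ub m : (0 < m)%N ->
  stirling_defect m <= ln (2 * pi) / 2 + (4 * m%:R)^-1.
Proof.
move=> m0.
have pi0 : (0 : R) < pi := pi_gt0 R.
have mR : (0 : R) < m%:R by rewrite ltr0n.
have := @stirling_defect_le m m.*2; rewrite m0 -addnn leq_addr addnn => /(_ isT).
have m2 : m.*2%:R = 2 * m%:R :> R by rewrite -natrM mul2n.
have f0 d : (0 : R) < d`!%:R by rewrite ltr0n fact_gt0.
rewrite {1}/stirling_defect m2 lnM ?posrE// => le1.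
have := @wallis_le R m.
rewrite -ler_ln ?posrE ?mulr_gt0 ?exprn_gt0 ?mulr_gt0 ?exprn_gt0 ?ltr0n ?fact_gt0//.
have -> : 4 = 2 * 2 :> R by ring.
rewrite !(lnM, lnXn) ?posrE ?mulr_gt0 ?exprn_gt0 ?mulr_gt0 ?exprn_gt0 ?ltr0n ?fact_gt0//.
have -> : m.*2.+1%:R = 2 * m%:R * (1 + (2 * m%:R)^-1) :> R.
  by rewrite -natr1 m2; field; rewrite gt_eqF.
rewrite !lnM ?posrE ?mulr_gt0 ?addr_gt0 ?invr_gt0 ?mulr_gt0//.
have lnu : ln (1 + (2 * m%:R)^-1) <= (2 * m%:R)^-1 :> R.
  by rewrite le_ln1Dx// (lt_trans (ltrN10 R))// invr_gt0 mulr_gt0.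
have -> : (2 * 2 * m%:R)^-1 = (2 * m%:R)^-1 / 2 :> R by field; rewrite gt_eqF.
move: le1; rewrite /stirling_defect -(mulr_natl (ln 2 + ln 2) m) => le1 le2; lra.
Qed.

Definition entropy_excess (d : nat) : R := lnfact_avg R d - ln d%:R + 1.

(** For d > 0 this is d! >= (d / e)^d, by induction from d ln (1 + 1/d) <= 1. At d = 0 the
    convention ln 0 = 0 makes the value 1. *)
Lemma entropy_excess_ge0 d : 0 <= entropy_excess d.
Proof.
case: d => [|d]; first by rewrite /entropy_excess /lnfact_avg fact0 ln1 ln0// mul0r subr0 add0r.
have dR : (0 : R) < d.+1%:R by rewrite ltr0n.
rewrite -(pmulr_rge0 _ dR) /entropy_excess mulrDr mulr1 mulrBr mul_lnfact_avg.
elim: d {dR} => [|d IH]; first by rewrite (_ : 1`! = 1)%N ?ln1 //; lra.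
have dR : (0 : R) < d.+1%:R by rewrite ltr0n.
rewrite factS natrM lnM ?posrE ?ltr0n ?fact_gt0//.
have := @le_ln1Dx R d.+1%:R^-1; rewrite (lt_trans (ltrN10 R)) ?invr_gt0// => /(_ isT).
have -> : 1 + d.+1%:R^-1 = d.+2%:R / d.+1%:R :> R.
  by rewrite -[d.+2%:R]natr1; field; rewrite gt_eqF.
rewrite ln_div ?posrE ?ltr0n// -(ler_pM2l dR) divff ?gt_eqF// -[d.+2%:R]natr1.
move: IH; lra.
Qed.

Lemma entropy_excess_le d : (0 < d)%N ->
  entropy_excess d <= ln (2 * pi * d%:R) / (2 * d%:R) + (4 * d%:R ^+ 2)^-1.
Proof.
move=> d0; have dR : (0 : R) < d%:R by rewrite ltr0n.
have pi0 : (0 : R) < pi := pi_gt0 R.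
have := stirling_defect_ub d0; rewrite /stirling_defect => h.
rewrite /entropy_excess /lnfact_avg lnM ?posrE ?mulr_gt0//.
set a := ln _ in h *; set b := ln d%:R in h *; set c := ln _ in h *.
rewrite -(ler_pM2l dR).
have -> : d%:R * (a / d%:R - b + 1) = a - d%:R * b + d%:R by field; rewrite gt_eqF.
have -> : d%:R * ((c + b) / (2 * d%:R) + (4 * d%:R ^+ 2)^-1) =
  c / 2 + b / 2 + (4 * d%:R)^-1 by field; rewrite gt_eqF.
lra.
Qed.

(** The term ln (2 pi d) / (2 d) is compared with the increment of ln (2 pi d)^2 / 4, and the
    summand - 1/n makes room for the quadratic errors, which it dominates by telescoping. *)
Lemma sum_entropy_excess n : (0 < n)%N ->
  \sum_(d < n) entropy_excess d.+1 <= ln (2 * pi * n%:R) ^+ 2 / 4 + 3 / 2 - n%:R^-1.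
Proof.
have pi0 : (0 : R) < pi := pi_gt0 R.
case: n => // n _; elim: n => [|n IH].
  rewrite big_ord1 (le_trans (entropy_excess_le _))// !mulr1 expr1n mulr1 invr1.
  (* For n = 1 the gap between the two bounds is exactly (c - 1)^2 / 4; the constant 3 / 2 is what
     makes it a square. *)
  set c := ln _; have := sqr_ge0 (c - 1); rewrite sqrrB1 -mulr_natl; lra.
rewrite big_ord_recr/= (le_trans (lerD IH (entropy_excess_le (ltn0Sn _))))//.
set x : R := n.+1%:R; have x1 : 1 <= x by rewrite ler1n.
have -> : n.+2%:R = x + 1 by rewrite natr1.
have x0 : 0 < x by exact: lt_le_trans x1.
have xS0 : 0 < x + 1 by rewrite addr_gt0.
clearbody x; move: (@pi R) pi0 (pi_ge2 R) => p pi0 pi2.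
set B := ln (2 * p * x); set A := ln (2 * p * (x + 1)).
have hE : A - B = ln (1 + x^-1).
  rewrite -ln_div ?posrE ?mulr_gt0//; congr ln; field.
  by rewrite (gt_eqF x0) (gt_eqF pi0).
have h_le : A - B <= x^-1.
  by rewrite hE le_ln1Dx// (lt_trans (ltrN10 R))// invr_gt0.
have h_ge : (x + 1)^-1 <= A - B.
  have := @le_ln1Dx R (- (x + 1)^-1).
  rewrite ltrN2 invf_lt1// ltrDr x0 => /(_ isT).
  have -> : 1 - (x + 1)^-1 = (1 + x^-1)^-1.
    by field; rewrite (gt_eqF x0) (gt_eqF xS0).
  by rewrite lnV ?posrE ?addr_gt0 ?invr_gt0// hE lerN2.
have A0 : 0 <= A.
  rewrite ln_ge0// -[1]mulr1 ler_pM//; last by lra.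
  lra.
have h0 : 0 <= A - B by rewrite (le_trans _ h_ge)// invr_ge0 ltW.
have hA : A * (x + 1)^-1 <= A * (A - B) by rewrite ler_wpM2l.
have hh : (A - B) ^+ 2 <= x^-1 ^+ 2 by rewrite lerXn2r ?nnegrE// invr_ge0 ltW.
(* From A^2 - B^2 = 2 A (A - B) - (A - B)^2 the comparison of increments loses at most 1 / (4 x^2);
   this and the error 1 / (4 (x + 1)^2) of Stirling's formula fit into 1/x - 1/(x + 1). *)
have key : x^-1 ^+ 2 / 4 + (4 * (x + 1) ^+ 2)^-1 <= x^-1 - (x + 1)^-1.
  rewrite -subr_ge0.
  have -> : x^-1 - (x + 1)^-1 - (x^-1 ^+ 2 / 4 + (4 * (x + 1) ^+ 2)^-1) =
    (2 * x ^+ 2 + 2 * x - 1) / (4 * x ^+ 2 * (x + 1) ^+ 2).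
    by field; rewrite (gt_eqF x0) (gt_eqF xS0).
  by rewrite divr_ge0 ?mulr_ge0 ?sqr_ge0//; nra.
have -> : A / (2 * (x + 1)) = A * (x + 1)^-1 / 2 by field; rewrite (gt_eqF xS0).
have e1 : (A - B) ^+ 2 = A ^+ 2 - 2 * (A * B) + B ^+ 2 by ring.
have e2 : A * (A - B) = A ^+ 2 - A * B by ring.
rewrite e1 in hh; rewrite e2 in hA.
lra.
Qed.

(** The excesses are nonnegative, so a partial column is bounded by a full one; here 3 / 2 is
    relaxed to 3. *)
Lemma sum_entropy_excess_rev n c : (0 < n)%N -> (c <= n)%N ->
  \sum_(t < c) entropy_excess (n - t) <= 3 + ln (2 * pi * n%:R) ^+ 2 / 4.
Proof.
move=> n0 cn.
apply: (@le_trans _ _ (\sum_(t < n) entropy_excess (n - t))).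
  rewrite (big_ord_widen _ (fun t => entropy_excess (n - t)) cn).
  rewrite [leRHS](bigID (fun t : 'I_n => (t < c)%N))/= lerDl.
  by rewrite sumr_ge0// => t _; exact: entropy_excess_ge0.
rewrite (reindex_inj rev_ord_inj)/=.
under eq_bigr do rewrite subKn//.
rewrite (le_trans (sum_entropy_excess n0))//.
have : 0 <= n%:R^-1 :> R by rewrite invr_ge0.
lra.
Qed.

(** Without the excesses the summands are ln d - 1 for the c largest d <= n, and their logarithms
    telescope to a quotient of factorials. *)
Lemma sum_lnfact_avg n c : (0 < n)%N -> (c <= n)%N ->
  \sum_(t < c) lnfact_avg R (n - t) <=
  ln n`!%:R - ln (n - c)`!%:R - c%:R + (3 + ln (2 * pi * n%:R) ^+ 2 / 4).
Proof.
move=> n0 cn; rewrite -lerBlDl; apply: le_trans (sum_entropy_excess_rev n0 cn).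
rewrite le_eqVlt; apply/orP; left; apply/eqP.
elim: c cn => [|c IH] cn; first by rewrite !big_ord0 subn0; lra.
rewrite !big_ord_recr/= -(IH (ltnW cn)) /entropy_excess.
have -> : (n - c = (n - c.+1).+1)%N by rewrite subnSK.
rewrite factS natrM lnM ?posrE ?ltr0n ?fact_gt0// -[c.+1%:R]natr1.
lra.
Qed.

End Stirling.

(** * The Gamma function *)

Section GammaBounds.
Import numFieldNormedType.Exports.
Local Open Scope classical_set_scope.
Variable R : realType.
Local Notation mu := (@lebesgue_measure R).

Definition gamma_kernel m (t : R) : R := t ^+ m * expR (- t).

(** An antiderivative of [gamma_kernel m], by repeated integration by parts. *)
Fixpoint gamma_primitive m (t : R) : R :=
  if m is p.+1 then m%:R * gamma_primitive p t - gamma_kernel m t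
  else - expR (- t).

Lemma is_derive_expRN (t : R) : is_derive t 1 (fun x => expR (- x)) (- expR (- t)).
Proof.
have h := is_derive1_comp (is_derive_expR (- t)) (is_deriveNid t (1 : R)).
by apply: (is_derive_eq h); rewrite mulrN1.
Qed.

Lemma is_derive_gamma_kernel m (t : R) :
  is_derive t 1 (gamma_kernel m.+1) (m.+1%:R * gamma_kernel m t - gamma_kernel m.+1 t).
Proof.
have E : gamma_kernel m.+1 = id ^+ m.+1 * (fun x => expR (- x)).
  by apply/funext => x; rewrite !fctE.
have h := is_deriveM (is_deriveX m.+1 (is_derive_id t (1 : R))) (is_derive_expRN t).
rewrite [X in is_derive _ _ X _]E; apply: (is_derive_eq h).
by rewrite /gamma_kernel exprfctE /GRing.scale /=; ring.
Qed.

Lemma is_derive_gamma_primitive m (t : R) :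
  is_derive t 1 (gamma_primitive m) (gamma_kernel m t).
Proof.
elim: m => [|m IH].
  have h := is_deriveN (is_derive_expRN t).
  by apply: (is_derive_eq h); rewrite opprK /gamma_kernel mul1r.
have h := is_deriveB (is_deriveZ m.+1%:R IH) (is_derive_gamma_kernel m t).
by apply: (is_derive_eq h); rewrite /GRing.scale /=; ring.
Qed.

Lemma gamma_primitive0 m : gamma_primitive m 0 = - m`!%:R.
Proof.
elim: m => [|m IH]; first by rewrite /= oppr0 expR0.
by rewrite /= IH /gamma_kernel expr0n mul0r subr0 factS natrM mulrN.
Qed.

Lemma gamma_kernel_cvg0 m : gamma_kernel m x @[x --> +oo] --> 0.
Proof.
apply/cvgrPdist_lt => e e0; near=> x.
have x0 : 0 < x by near: x; apply: nbhs_pinfty_gt; exact: num_real.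
have f0 : (0 : R) < m.+1`!%:R by rewrite ltr0n fact_gt0.
rewrite sub0r normrN ger0_norm ?mulr_ge0 ?exprn_ge0 ?expR_ge0 ?ltW//.
rewrite /gamma_kernel expRN ltr_pdivrMr ?expR_gt0//.
(* The threshold comes from exp x >= x^(m+1) / (m+1)!, which bounds the kernel by (m+1)! / x. *)
have xe : m.+1`!%:R / e < x by near: x; apply: nbhs_pinfty_gt; exact: num_real.
have h : x ^+ m.+1 / m.+1`!%:R <= expR x.
  by have := expR_ge1Dxn m (ltW x0); lra.
apply: lt_le_trans (ler_wpM2l (ltW e0) h).
rewrite exprS [ltRHS](_ : _ = x ^+ m * (x / (m.+1`!%:R / e))).
  by rewrite ltr_pMr ?exprn_gt0// ltr_pdivlMr ?divr_gt0// mul1r.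
by field; rewrite (gt_eqF e0) (gt_eqF f0).
Unshelve. all: end_near. Qed.

Lemma gamma_primitive_cvg0 m : gamma_primitive m x @[x --> +oo] --> 0.
Proof.
elim: m => [|m IH]; first by rewrite -oppr0; apply: cvgN; exact: cvgr_expR.
rewrite -[0](_ : m.+1%:R * 0 - 0 = 0); last by rewrite mulr0 subr0.
apply: cvgB; last exact: gamma_kernel_cvg0.
by apply: cvgM => //; exact: cvg_cst.
Qed.

Lemma continuous_gamma_kernel m : continuous (gamma_kernel m).
Proof.
move=> x; apply/differentiable_continuous/derivable1_diffP.
case: m => [|m]; last by have [] := is_derive_gamma_kernel m x.
have -> : gamma_kernel 0 = (fun x => expR (- x)).
  by apply/funext => y; rewrite /gamma_kernel mul1r.
by have [] := is_derive_expRN x.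
Qed.

Lemma gamma_kernel_ge0 m (t : R) : 0 <= t -> 0 <= gamma_kernel m t.
Proof. by move=> t0; rewrite mulr_ge0 ?exprn_ge0 ?expR_ge0. Qed.

Lemma measurable_gamma_kernel m (D : set R) :
  measurable D -> measurable_fun D (gamma_kernel m).
Proof.
move=> mD; apply: measurable_funTS.
apply: open_continuous_measurable_fun; first exact: openT.
by move=> x _; exact: continuous_gamma_kernel.
Qed.

Lemma integral_gamma_kernel m :
  (\int[mu]_(t in `]0%R, +oo[) (gamma_kernel m t)%:E = (m`!%:R)%:E)%E.
Proof.
rewrite integral_itv_obnd_cbnd; last first.
  by apply/measurable_EFinP; exact: measurable_gamma_kernel.
rewrite (@ge0_continuous_FTC2y _ _ (gamma_primitive m) _ 0).
- by rewrite gamma_primitive0 EFinN oppeK add0e.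
- by move=> x; exact: gamma_kernel_ge0.
- exact/continuous_subspaceT/continuous_gamma_kernel.
- exact: gamma_primitive_cvg0.
- by move=> x _; have [] := is_derive_gamma_primitive m x.
- apply/cvg_at_right_filter/differentiable_continuous/derivable1_diffP.
  by have [] := is_derive_gamma_primitive m 0.
- move=> x _; rewrite derive1E.
  by have [] := is_derive_gamma_primitive m x.
Qed.

Lemma integrable_gamma_kernel m : mu.-integrable `]0, +oo[ (EFin \o gamma_kernel m).
Proof.
apply/integrableP; split; first by apply/measurable_EFinP; exact: measurable_gamma_kernel.
rewrite [ltLHS](_ : _ = (m`!%:R)%:E) ?ltry//.
rewrite -integral_gamma_kernel; apply: eq_integral => t.
rewrite inE/= in_itv/= andbT => t0.
by rewrite ger0_norm// gamma_kernel_ge0// ltW.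
Qed.

Lemma Rintegral_gamma_kernel m :
  \int[mu]_(t in `]0, +oo[) gamma_kernel m t = m`!%:R.
Proof. by rewrite /Rintegral integral_gamma_kernel. Qed.

Lemma rfact_nat m : rfact (m%:R : R) = m`!%:R.
Proof.
rewrite -Rintegral_gamma_kernel /rfact /Gamma; apply: eq_Rintegral => t.
rewrite inE/= in_itv/= andbT => t0.
by rewrite addrK powR_mulrn// ltW.
Qed.

Lemma integrable_mul_gamma_kernel m (a : R) :
  mu.-integrable `]0, +oo[ (EFin \o (fun t => a * gamma_kernel m t)).
Proof. exact: (integrableZl _ a (integrable_gamma_kernel m)). Qed.

Lemma integrable_gamma_comb m (a b : R) : mu.-integrable `]0, +oo[
  (EFin \o (fun t => a * gamma_kernel m t + b * gamma_kernel m.+1 t)).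
Proof.
exact: (integrableD _ (integrable_mul_gamma_kernel m a)
                      (integrable_mul_gamma_kernel m.+1 b)).
Qed.

Lemma Rintegral_gamma_comb m (a b : R) :
  \int[mu]_(t in `]0, +oo[) (a * gamma_kernel m t + b * gamma_kernel m.+1 t) =
  a * m`!%:R + b * m.+1`!%:R.
Proof.
rewrite RintegralD//; [|exact: integrable_mul_gamma_kernel..].
by rewrite !RintegralZl ?Rintegral_gamma_kernel//; exact: integrable_gamma_kernel.
Qed.

(** Weighted AM-GM for u and 1 with weights q and 1 - q. *)
Lemma powR_le_affine (u q : R) : 0 < u -> 0 <= q <= 1 -> u `^ q <= 1 - q + q * u.
Proof.
move=> u0 /andP[q0 q1].
have v0 : 0 < 1 - q + q * u.
  have [->|qN0] := eqVneq q 0; first by lra.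
  by rewrite ltr_wpDl ?subr_ge0// mulr_gt0// lt0r qN0.
rewrite -ler_ln ?posrE ?powR_gt0// ln_powR.
set v := 1 - q + q * u in v0 *.
have h (x : R) : 0 < x -> ln x - ln v <= x / v - 1.
  move=> x0; rewrite -ln_div ?posrE//.
  have := @le_ln1Dx R (x / v - 1); rewrite (addrC 1) subrK; apply.
  by rewrite ltrBrDl addrN divr_gt0.
(* The tangent of ln at the mean v bounds ln u and ln 1; weighted by q and 1 - q, the linear terms
   cancel. *)
have h1 := h _ u0; have h2 := h 1 ltr01.
have : q * (ln u - ln v) + (1 - q) * (ln 1 - ln v) <= q * (u / v - 1) + (1 - q) * (1 / v - 1).
  by rewrite lerD// ler_wpM2l// subr_ge0.
have -> : q * (u / v - 1) + (1 - q) * (1 / v - 1) = v / v - 1 by rewrite /v; ring.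
rewrite divff ?gt_eqF// ln1; lra.
Qed.

(** * Gamma between consecutive integers *)

Section Interpolation.
Variables (m : nat) (q : R).
Hypothesis q01 : 0 <= q <= 1.

Let f (t : R) : R := t `^ (m%:R + q + 1 - 1) * expR (- t).

Let fE t : 0 < t -> f t = t `^ q * gamma_kernel m t.
Proof.
move=> t0; rewrite /f addrK powRD; last by rewrite (gt_eqF t0) implybT.
by rewrite powR_mulrn ?ltW// /gamma_kernel; ring.
Qed.

(** The mean of the density t^m e^(-t) / m!: the affine bound on (t / c)^q then has mean exactly
    1. *)
Let c : R := m.+1%:R.

Let f_le t : 0 < t -> f t <= c `^ q * (1 - q) * gamma_kernel m t +
  c `^ q * q / c * gamma_kernel m.+1 t.
Proof.
move=> t0; rewrite fE//.
have c0 : 0 < c by rewrite ltr0n.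
have h : t `^ q <= c `^ q * (1 - q + q * (t / c)).
  have := powR_le_affine (divr_gt0 t0 c0) q01.
  rewrite -(ler_pM2l (powR_gt0 q c0)) => /(le_trans _); apply.
  have tc : c * (t / c) = t by field; rewrite gt_eqF.
  by rewrite -powRM ?tc// ltW// divr_gt0.
have := ler_wpM2r (gamma_kernel_ge0 m (ltW t0)) h.
move=> /le_trans; apply; rewrite le_eqVlt; apply/orP; left; apply/eqP.
by rewrite /gamma_kernel exprS; ring.
Qed.

(* [d t - (d t / 2)^2 <= min(t, 1) <= t `^ q] for [0 <= d <= 1]; with this
   value of [d] the resulting lower bound for the integral is positive. *)
Let d : R := m.+2%:R^-1.

Let f_ge t : 0 < t -> d * gamma_kernel m.+1 t + - (d ^+ 2 / 4) * gamma_kernel m.+2 t <= f t.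
Proof.
move=> t0; rewrite fE//.
have d0 : 0 < d by rewrite invr_gt0.
have d1 : d <= 1 by rewrite invf_le1// ler1n.
have h : d * t - (d * t / 2) ^+ 2 <= t `^ q.
  have [t1|t1] := leP t 1.
    rewrite (@le_trans _ _ t)//; last by rewrite ger1_powR ?t0//; case/andP: q01.
    have : d * t <= t by rewrite ler_piMl// ltW.
    by have := sqr_ge0 (d * t / 2); lra.
  rewrite (@le_trans _ _ 1)//.
    have := sqr_ge0 (d * t / 2 - 1); rewrite sqrrB1 -mulr_natr; lra.
  have := @ler_powR R t (ltW t1) 0 q; rewrite powRr0; apply.
  by case/andP: q01.
have := ler_wpM2r (gamma_kernel_ge0 m (ltW t0)) h.
apply: le_trans; rewrite le_eqVlt; apply/orP; left; apply/eqP.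
by rewrite /gamma_kernel !exprS; field.
Qed.

Let integrable_f : mu.-integrable `]0, +oo[ (EFin \o f).
Proof.
apply: (le_integrable _ _ _ (integrable_gamma_comb m (c `^ q * (1 - q)) (c `^ q * q / c))) => //.
- apply/measurable_EFinP; apply: measurable_funM.
    by apply: measurable_funTS; exact: measurable_powR.
  by apply: measurableT_comp => //; apply: measurableT_comp.
- move=> t; rewrite /= in_itv/= andbT => t0; rewrite lee_fin.
  rewrite ger0_norm; last by rewrite mulr_ge0 ?powR_ge0 ?expR_ge0.
  by rewrite (le_trans (f_le t0))// ler_norm.
Qed.

Lemma rfact_interp_gt0 : 0 < rfact (m%:R + q).
Proof.
rewrite /rfact /Gamma -/f.
apply: (@lt_le_trans _ _ (d * m.+1`!%:R + - (d ^+ 2 / 4) * m.+2`!%:R)).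
  rewrite (factS m.+1) natrM.
  (* Since d (m + 2) = 1, the negative term is a quarter of the positive one. *)
  have -> : d * m.+1`!%:R + - (d ^+ 2 / 4) * (m.+2%:R * m.+1`!%:R) = d * m.+1`!%:R * (3 / 4).
    have : m.+2%:R != 0 :> R by rewrite pnatr_eq0.
    by rewrite /d; move: (m.+2%:R : R) (m.+1`!%:R : R) => x y x0; field.
  by rewrite !mulr_gt0 ?invr_gt0// ltr0n fact_gt0.
rewrite -Rintegral_gamma_comb; apply: le_Rintegral => //.
- exact: integrable_gamma_comb.
- by move=> t; rewrite /= in_itv/= andbT; exact: f_ge.
Qed.

(** The right side is m!^(1-q) (m+1)!^q, so this is log-convexity of Gamma between consecutive
    integers, obtained by integrating the affine bound on t^q. *)
Lemma rfact_interp_le : rfact (m%:R + q) <= m`!%:R * m.+1%:R `^ q.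
Proof.
rewrite /rfact /Gamma -/f.
apply: (@le_trans _ _ (c `^ q * (1 - q) * m`!%:R + c `^ q * q / c * m.+1`!%:R)).
  rewrite -Rintegral_gamma_comb; apply: le_Rintegral => //.
  - exact: integrable_gamma_comb.
  - by move=> t; rewrite /= in_itv/= andbT; exact: f_le.
rewrite factS natrM -/c le_eqVlt; apply/orP; left; apply/eqP.
have : c != 0 by rewrite pnatr_eq0.
by move: (c `^ q) (m`!%:R : R) c => x y z z0; field.
Qed.

End Interpolation.

(** The increments ln (m + 1) of ln m! increase with m, so the line through its values at m and m +
    1 lies below it at every integer. *)
Lemma ln_fact_ge_tangent a m :
  ln m`!%:R + (a%:R - m%:R) * ln m.+1%:R <= ln a`!%:R :> R.
Proof.
have f0 d : (0 : R) < d`!%:R by rewrite ltr0n fact_gt0.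
have lnS d : ln d.+1`!%:R = ln d.+1%:R + ln d`!%:R :> R.
  by rewrite factS natrM lnM ?posrE ?ltr0n ?fact_gt0.
have [am|/ltnW ma] := leqP m a.
  rewrite -(subnK am); elim: (a - m)%N => [|d IH]; first by rewrite add0n subrr mul0r addr0.
  rewrite addSn lnS -[(d + m).+1%:R in X in X <= _]natr1.
  have : ln m.+1%:R <= ln (d + m).+1%:R :> R.
    by rewrite ler_ln ?posrE ?ltr0n// ler_nat ltnS leq_addl.
  by move: IH; lra.
suff : ln m`!%:R <= ln a`!%:R + (m%:R - a%:R) * ln m.+1%:R :> R by lra.
rewrite -(subnK ma); elim: (m - a)%N => [|d IH]; first by rewrite add0n subrr mul0r addr0.
rewrite addSn lnS.
have Sd : (d + a).+1%:R - a%:R = d%:R + 1 :> R by rewrite -natr1 natrD; ring.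
have dE : (d + a)%:R - a%:R = d%:R :> R by rewrite natrD addrK.
rewrite Sd; rewrite dE in IH.
have le_lnS : ln (d + a).+1%:R <= ln (d + a).+2%:R :> R.
  by rewrite ler_ln ?posrE ?ltr0n// ler_nat.
have : (d%:R + 1) * ln (d + a).+1%:R <= (d%:R + 1) * ln (d + a).+2%:R :> R.
  by rewrite ler_wpM2l// addr_ge0.
by move: IH; lra.
Qed.

(** Euclidean division writes the mean as m + q. The line through (m, ln m!) and (m + 1, ln (m+1)!)
    lies above the logarithm of [rfact] at m + q and below ln a! at each integer a; being affine, it
    commutes with averaging. *)
Lemma rfact_mean n (a : 'I_n -> nat) : (0 < n)%N ->
  0 < rfact ((\sum_i a i)%N%:R / n%:R : R) /\
  n%:R * ln (rfact ((\sum_i a i)%N%:R / n%:R : R)) <= \sum_i ln (a i)`!%:R.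
Proof.
move=> n0; set s := (\sum_i a i)%N.
pose m := (s %/ n)%N; pose q : R := (s %% n)%:R / n%:R.
have nR : (0 : R) < n%:R by rewrite ltr0n.
have q01 : 0 <= q <= 1.
  by rewrite divr_ge0// ler_pdivrMr// mul1r ler_nat ltnW// ltn_mod.
have sE : s%:R / n%:R = m%:R + q :> R.
  by rewrite /q {1}(divn_eq s n) natrD natrM; field; rewrite gt_eqF.
rewrite sE; split; first exact: rfact_interp_gt0.
have f0 d : (0 : R) < d`!%:R by rewrite ltr0n fact_gt0.
have mS : (0 : R) < m.+1%:R by rewrite ltr0n.
apply: (@le_trans _ _ (n%:R * (ln m`!%:R + q * ln m.+1%:R))).
  rewrite ler_pM2l// -ln_powR -lnM ?posrE ?powR_gt0//.
  by rewrite ler_ln ?posrE ?mulr_gt0 ?powR_gt0 ?rfact_interp_gt0// rfact_interp_le.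
apply: (@le_trans _ _ (\sum_i (ln m`!%:R + ((a i)%:R - m%:R) * ln m.+1%:R))); last first.
  by apply: ler_sum => i _; exact: ln_fact_ge_tangent.
rewrite big_split/= -mulr_suml sumrB !sumr_const card_ord -natr_sum -/s.
rewrite -(mulr_natl (ln _) n) -(mulr_natl m%:R n).
have -> : q = s%:R / n%:R - m%:R by rewrite sE; ring.
rewrite le_eqVlt; apply/orP; left; apply/eqP.
by field; rewrite gt_eqF.
Qed.

End GammaBounds.

(** * The bound *)

Lemma sum_row_size n (S : {set 'I_n * 'I_n}) :
  (\sum_i row_size S i = #|S|)%N.
Proof.
rewrite -sum1_card (eq_bigr (fun i => (\sum_(j | (i, j) \in S) 1)%N)); last first.
  by move=> i _; rewrite /row_size -sum1_card; apply: eq_bigl => j; rewrite inE.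
by rewrite pair_big_dep/=; apply: eq_bigl => -[i j].
Qed.

Lemma sum_col_size n (S : {set 'I_n * 'I_n}) :
  (\sum_j col_size S j = #|S|)%N.
Proof.
rewrite -sum_row_size.
rewrite (eq_bigr (fun j => (\sum_(i | (i, j) \in S) 1)%N)); last first.
  by move=> j _; rewrite /col_size -sum1_card; apply: eq_bigl => i; rewrite inE.
rewrite (exchange_big_dep xpredT)//=; apply: eq_bigr => i _.
by rewrite /row_size -sum1_card; apply: eq_bigl => j; rewrite inE.
Qed.

(** * Averaging over lines, for rows and columns alike *)

Section LineSizes.
Variables (R : realType) (n k : nat) (r : 'I_n -> nat).
Hypotheses (n0 : (0 < n)%N) (r_le : forall i, (r i <= n)%N)
  (sum_r : (\sum_i r i = k)%N).

Lemma sum_subn_natr : \sum_i (n - r i)%:R = n%:R * n%:R - k%:R :> R.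
Proof.
rewrite -sum_r natr_sum (eq_bigr (fun i => n%:R - (r i)%:R)); last first.
  by move=> i _; rewrite natrB.
by rewrite sumrB sumr_const card_ord mulr_natl.
Qed.

Lemma rfact_mean_subn :
  0 < rfact (n%:R - k%:R / n%:R : R) /\
  n%:R * ln (rfact (n%:R - k%:R / n%:R : R)) <= \sum_i ln (n - r i)`!%:R.
Proof.
have nN0 : n%:R != 0 :> R by rewrite pnatr_eq0 -lt0n.
have -> : n%:R - k%:R / n%:R = (\sum_i (n - r i))%N%:R / n%:R :> R.
  by rewrite natr_sum sum_subn_natr; move: (n%:R : R) nN0 => x x0; field.
exact: rfact_mean.
Qed.

End LineSizes.

(** In the logarithm, the n^2 - k empty cells give (n - k/n) ln n! and the columns n ln n!, whence
    the exponent 2n - k/n. The row and column factorials are each at least n ln G in total, whence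
    the power 2n of G. *)
Lemma card_fillings_le (R : realType) n (S : {set 'I_n * 'I_n}) : (0 < n)%N ->
  #|fillings S|%:R <=
    (rfact (n%:R : R) `^ (2 * n%:R - #|S|%:R / n%:R) *
      expR (n%:R * (3 + ln (2 * pi * n%:R) ^+ 2 / 4))) /
     (rfact (n%:R - #|S|%:R / n%:R : R) ^+ (2 * n) * expR #|S|%:R).
Proof.
move=> n0; set k := #|S|.
have nR : (0 : R) < n%:R by rewrite ltr0n.
have row_le i : (row_size S i <= n)%N.
  by rewrite -[leqRHS]card_ord; exact: max_card.
have col_le j : (col_size S j <= n)%N.
  by rewrite -[leqRHS]card_ord; exact: max_card.
have [G0 rowG] := @rfact_mean_subn R n k _ n0 row_le (sum_row_size S).
have [_ colG] := @rfact_mean_subn R n k _ n0 col_le (sum_col_size S).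
have f0 : (0 : R) < n`!%:R by rewrite ltr0n fact_gt0.
rewrite rfact_nat.
set G := rfact _ in G0 rowG colG *.
set E := 3 + _.
set B := (X in _ <= X).
have B0 : 0 < B by rewrite divr_gt0 ?mulr_gt0 ?powR_gt0 ?exprn_gt0 ?expR_gt0.
have lnB : ln B = (2 * n%:R - k%:R / n%:R) * ln n`!%:R + n%:R * E -
    (2 * n%:R * ln G + k%:R).
  rewrite ln_div ?posrE ?mulr_gt0 ?powR_gt0 ?exprn_gt0 ?expR_gt0//.
  rewrite !lnM ?posrE ?powR_gt0 ?exprn_gt0 ?expR_gt0//.
  by rewrite ln_powR !expRK lnXn// -(mulr_natl (ln G)) natrM.
rewrite (le_trans (card_fillings R S))// -[leRHS]lnK ?posrE// ler_expR lnB.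
have col_sum : \sum_j \sum_(t < col_size S j) lnfact_avg R (n - t) <=
    \sum_j (ln n`!%:R - ln (n - col_size S j)`!%:R - (col_size S j)%:R + E).
  by apply: ler_sum => j _; exact: sum_lnfact_avg.
clearbody E; apply: (le_trans (lerD (lexx _) col_sum)).
rewrite !big_split/= !sumrN -mulr_suml (@sum_subn_natr R n k)//; last exact: sum_row_size.
rewrite !sumr_const card_ord -(natr_sum _ _ _ (fun j => col_size S j)) sum_col_size -/k.
rewrite -(mulr_natl (ln n`!%:R) n) -(mulr_natl E n) /lnfact_avg.
have -> : (n%:R * n%:R - k%:R) * (ln n`!%:R / n%:R) =
    n%:R * ln n`!%:R - k%:R / n%:R * ln n`!%:R :> R.
  by move: (n%:R : R) (ln _) nR => x y x0; field; rewrite gt_eqF.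
lra.
Qed.

Unset Implicit Arguments.

Theorem theorem3 (R : realType) (n k : nat) (hn : (0 < n)%N)
    (hk : (k <= n ^ 2)%N) :
  ((num_pls n k)%:R : R) <=
    'C(n ^ 2, k)%:R *
    ((rfact (n%:R : R) `^ (2 * n%:R - k%:R / n%:R) *
      expR (n%:R * (3 + ln (2 * pi * n%:R) ^+ 2 / 4))) /
     (rfact (n%:R - k%:R / n%:R : R) ^+ (2 * n) * expR k%:R)).
Proof.
have <- : #|[set S : {set 'I_n * 'I_n} | #|S| == k]%SET| = 'C(n ^ 2, k).
  by rewrite card_draws card_prod card_ord.
rewrite num_pls_sum natr_sum mulr_natl -sumr_const.
rewrite [leRHS](eq_bigl (fun S : {set 'I_n * 'I_n} => #|S| == k)); last first.
  by move=> S; rewrite inE.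
by apply: ler_sum => S /eqP <-; exact: card_fillings_le.
Qed.
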